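(* Let $n \geq 11$ be an integer and let $Q_n$ be the $n$-dimensional hypercube graph. Then $b_4(Q_n) = n-1$.
   Context: All graphs are finite, simple and undirected. The hypercube $Q_n$ has vertex set the power set of $[n]=\{1,\dots,n\}$, with $u,v$ adjacent iff $|u\Delta v|=1$. $k$-liminal burning game on $G$ ($k$ a positive integer): two players, Saboteur and Arsonist. Each vertex is burned or unburned, and revealed or unrevealed; initially all are unburned and unrevealed. In each round: (i) propagation: every unburned vertex with a neighbor burned in an earlier round becomes burned (whether revealed or not); (ii) the Saboteur reveals $k$ vertices that are unrevealed and unburned (all such vertices if fewer than $k$ exist); revealed vertices stay revealed; (iii) the Arsonist burns one revealed unburned vertex (revealed in this or any earlier round), if one exists. The game ends in the round in which all vertices are burned. The Saboteur maximizes and the Arsonist minimizes the number of rounds; $b_k(G)$ is the number of rounds under optimal play. *)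

(* Defs.v *)
From mathcomp Require Import all_boot.

Set Implicit Arguments.
Unset Strict Implicit.
Unset Printing Implicit Defensive.

Record sgraph := SGraph {
  vertex :> finType;
  adj : rel vertex;
  adj_sym : symmetric adj;
  adj_irr : irreflexive adj
}.

Section Hypercube.

Variable n : nat.

Definition symdiff (u v : {set 'I_n}) : {set 'I_n} := (u :\: v) :|: (v :\: u).

Definition cube_adj : rel {set 'I_n} := fun u v => #|symdiff u v| == 1.

Fact cube_adj_sym : symmetric cube_adj.
Proof. by move=> u v; rewrite /cube_adj /symdiff setUC. Qed.

Fact cube_adj_irr : irreflexive cube_adj.
Proof. by move=> u; rewrite /cube_adj /symdiff setDv setU0 cards0. Qed.

Definition hypercube : sgraph := SGraph cube_adj_sym cube_adj_irr.

End Hypercube.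

(* A position, at the end of a round, consists of the set B of burned vertices
   and the set R of revealed vertices; a vertex may belong to both. *)
Section LiminalBurning.

Variables (G : sgraph) (k : nat).
Implicit Types B R S : {set G}.

Definition propagate B : {set G} :=
  B :|: [set v | [exists u in B, adj u v]].

Definition saboteur_move B R S : bool :=
  (S \subset ~: (B :|: R)) && (#|S| == minn k #|~: (B :|: R)|).

(* The burned sets the Arsonist can produce. The Arsonist may not pass unless
   every revealed vertex is burned. *)
Definition arsonist_outcomes B R : {set {set G}} :=
  if R \subset B then [set B] else [set v |: B | v in R :\: B].

(* Number of further rounds under optimal play from the position (B, R), by
   backward induction. The argument m is a recursion bound, irrelevant as soon
   as m >= #|~: B| and k > 0, see rounds_bound_irrelevant and roundsE. The
   minimum ranges over a nonempty set of values that are at most m', so its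
   default m' does not affect it. *)
Fixpoint rounds (m : nat) B R : nat :=
  if B == setT then 0 else
  if m is m'.+1 then
    (\max_(S | saboteur_move (propagate B) R S)
       \big[minn/m']_(B' in arsonist_outcomes (propagate B) (R :|: S))
          rounds m' B' (R :|: S)).+1
  else 0.

(* b_k(G), for k > 0: the game lasts at most #|G| rounds. *)
Definition liminal_burning_number : nat := rounds #|G| set0 set0.

Lemma rounds_le m B R : rounds m B R <= m.
Proof.
elim: m B R => [|m IH] B R /=; case: ifP => // _.
rewrite ltnS; apply/bigmax_leqP => S _.
by elim/big_rec: _ => // B' x _ _; rewrite geq_min IH.
Qed.

Lemma card_setC_eq0 B : (#|~: B| == 0) = (B == setT).
Proof. by rewrite cards_eq0 -(inj_eq (@setC_inj _)) setCK setC0. Qed.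

Lemma propagate_sub B : B \subset propagate B.
Proof. exact: subsetUl. Qed.

Lemma saboteur_move_exists B R : exists S, saboteur_move B R S.
Proof.
set U := ~: (B :|: R); exists [set x in take k (enum U)].
apply/andP; split.
  by apply/subsetP => x; rewrite inE => /mem_take; rewrite mem_enum.
rewrite cardsE (card_uniqP _) ?take_uniq ?enum_uniq //.
by rewrite size_take_min -cardE.
Qed.

Lemma arsonist_outcomes_neq0 B R : arsonist_outcomes B R != set0.
Proof.
rewrite /arsonist_outcomes; case: ifPn => [_|/subsetPn[v vR vB]].
  by apply/set0Pn; exists B; rewrite inE.
by apply/set0Pn; exists (v |: B); apply/imsetP; exists v; rewrite ?inE ?vB.
Qed.

Lemma round_progress B R S B' : 0 < k -> B != setT ->
  saboteur_move (propagate B) R S ->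
  B' \in arsonist_outcomes (propagate B) (R :|: S) -> #|~: B'| < #|~: B|.
Proof.
move=> k0 BT /andP[sS /eqP cS]; set P := propagate B in sS cS *.
have sBP : B \subset P := propagate_sub B.
rewrite /arsonist_outcomes; case: ifP => [sRP|_].
  move/set1P->; apply: proper_card; rewrite properEneq setCS sBP andbT.
  apply/negP => /eqP /setC_inj EP; have : S == set0.
    rewrite -subset0; apply/subsetP => x xS.
    have xP : x \in P by apply: (subsetP sRP); rewrite inE xS orbT.
    by have := subsetP sS x xS; rewrite in_setC in_setU xP.
  move=> /eqP S0; move: cS; rewrite S0 cards0 => /esym/eqP.
  rewrite -leqn0 geq_min leqNgt k0 /= leqn0 card_setC_eq0 => /eqP C0.
  have /setUidPl PR : R \subset P := subset_trans (subsetUl _ _) sRP.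
  by move: C0; rewrite PR EP => C0; rewrite C0 eqxx in BT.
case/imsetP => v /setDP[_ vP] ->.
apply: proper_card; apply/properP; split.
  by rewrite setCS (subset_trans sBP) ?subsetUr.
exists v; rewrite !inE ?eqxx //.
by apply: contra vP; apply: (subsetP sBP).
Qed.

Lemma rounds_bound_irrelevant m m' B R : 0 < k ->
  #|~: B| <= m -> #|~: B| <= m' -> rounds m B R = rounds m' B R.
Proof.
move=> k0.
have bigminE (c d : nat) (A : {set {set G}}) (F : {set G} -> nat) :
    A != set0 -> (forall X, X \in A -> F X <= c) ->
    (forall X, X \in A -> F X <= d) ->
    \big[minn/c]_(X in A) F X = \big[minn/d]_(X in A) F X.
  move=> /set0Pn[X XA] Fc Fd.
  pose low t := has (fun Y => (Y \in A) && (F Y <= t)) (index_enum {set G}).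
  have geq_bigmin e t : F X <= e -> (\big[minn/e]_(Y in A) F Y <= t) = low t.
    move=> Fe; have -> : (\big[minn/e]_(Y in A) F Y <= t) = (e <= t) || low t.
      rewrite /low; elim: (index_enum _) => [|Y s IH].
        by rewrite big_nil orbF.
      by rewrite big_cons /=; case: ifP => _ //; rewrite geq_min IH orbCA.
    apply: orb_idl => et; apply/hasP; exists X; first exact: mem_index_enum.
    by rewrite XA (leq_trans Fe).
  apply/eqP; rewrite eqn_leq geq_bigmin ?Fc // -(geq_bigmin d) ?Fd // leqnn.
  by rewrite geq_bigmin ?Fd // -(geq_bigmin c) ?Fc // leqnn.
elim: m m' B R => [|m IH] [|m'] B R //=; case: eqVneq => // BT.
- by rewrite leqn0 card_setC_eq0 (negbTE BT).
- by move=> _; rewrite leqn0 card_setC_eq0 (negbTE BT).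
move=> Bm Bm'; congr _.+1; apply: eq_bigr => S mS.
rewrite (eq_bigr (fun B' => rounds m' B' (R :|: S))) => [|B' oB']; last first.
  by apply: IH; rewrite -ltnS (leq_trans (round_progress k0 BT mS oB')).
apply: bigminE => [|B' oB'|B' _]; first exact: arsonist_outcomes_neq0.
  rewrite -(IH m') ?rounds_le //;
  by rewrite -ltnS (leq_trans (round_progress k0 BT mS oB')).
exact: rounds_le.
Qed.

Lemma roundsE B R : 0 < k -> B != setT ->
  rounds #|~: B| B R =
  (\max_(S | saboteur_move (propagate B) R S)
     \big[minn/#|~: B|.-1]_(B' in arsonist_outcomes (propagate B) (R :|: S))
        rounds #|~: B'| B' (R :|: S)).+1.
Proof.
move=> k0 BT; case E: #|~: B| => [|m] /=.
  by move/eqP: E; rewrite card_setC_eq0 (negbTE BT).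
rewrite (negbTE BT); congr _.+1; apply: eq_bigr => S mS.
apply: eq_bigr => B' oB'; apply: rounds_bound_irrelevant => //.
by rewrite -ltnS -E; apply: round_progress mS oB'.
Qed.

End LiminalBurning.

(* Main.v *)
Require Import Defs.
From mathcomp Require Import all_boot zify.

(* Write v_t for the vertex burned in round t and c = v_1; sizes and complements
   are relative to c, i.e. v has size |c ^ v|, with ^ the symmetric difference.

   Upper bound: the Arsonist burns anything he can. If some v_t has size at
   least t + 2, then the fires from c and v_t cover the cube by round n - 1.
   Otherwise the antipode of c is still unburned in round n - 2, and he picks
   in that round a vertex after which at most one vertex survives the next
   propagation. The only candidates that fail are the vertices whose complement
   is (V2 :\: V3) :|: Q, with V2, V3 the sets of v_2, v_3 and Q a subset of
   V3 :\: V2 of size at most 1. There are at most three of them, because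
   V3 :\: V2 has at most two elements, whereas the Saboteur must reveal four
   vertices, or else all that remain, including the antipode.

   Lower bound: the Saboteur reveals first a 4-cycle, then 4-sets T_2, ...,
   T_(n-3) fixed in advance up to translation by c. They keep T_t unburned until
   round t, and two vertices of a set T_(n-2) unburned in round n - 2, provided
   that vertices of T_s and T_t with s < t are at distance greater than t - s.
   In T_t he uses sets of size t for t < 5, and for t >= 5 sets of size t + 1
   with a common element x; the targets T_(n-2) are the antipode of c and its
   neighbor without x. The distance condition then says that the sets of each
   of the two phases form an antichain. *)

Set Implicit Arguments.
Unset Strict Implicit.
Unset Printing Implicit Defensive.

(** * One-round bounds for the value of the game, and monotone spread of the fire *)

Section Game.

Variables (G : sgraph) (k : nat).
Implicit Types B R S : {set G}.

Lemma rounds_setT m R : rounds k m [set: G] R = 0.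
Proof. by case: m => [|m] /=; rewrite eqxx. Qed.

Lemma rounds_leS m j B R :
  (forall S, saboteur_move k (propagate B) R S ->
    exists2 B', B' \in arsonist_outcomes (propagate B) (R :|: S) &
                rounds k m B' (R :|: S) <= j) ->
  rounds k m.+1 B R <= j.+1.
Proof.
move=> H /=; case: ifP => // _; rewrite ltnS.
apply/bigmax_leqP => S /H [B' oB'].
apply: leq_trans; have := mem_index_enum B'; elim: (index_enum _) => //= X s IH.
rewrite inE big_cons => /predU1P[<-|/IH le_s]; first by rewrite oB' geq_minl.
by case: ifP => _ //; rewrite geq_min le_s orbT.
Qed.

(** The assumption [j <= m] covers the default [m] of the minimum over outcomes in [rounds]. *)
Lemma rounds_geS m j B R S : B != setT -> j <= m ->
  saboteur_move k (propagate B) R S ->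
  (forall B', B' \in arsonist_outcomes (propagate B) (R :|: S) ->
    j <= rounds k m B' (R :|: S)) ->
  j < rounds k m.+1 B R.
Proof.
move=> /negbTE BT jm mS H /=; rewrite BT ltnS.
apply: (leq_trans _ (leq_bigmax_cond _ mS)).
by elim/big_rec: _ => // B' x /H jB' jx; rewrite leq_min jB'.
Qed.

Lemma propagate0 : propagate (set0 : {set G}) = set0.
Proof.
rewrite /propagate set0U; apply/setP => v; rewrite !inE.
by apply/existsP => -[u]; rewrite inE.
Qed.

Lemma propagateS B B' : B \subset B' -> propagate B \subset propagate B'.
Proof.
move=> sBB'; rewrite setUSS //; apply/subsetP => v; rewrite !inE.
case/existsP => u /andP[uB auv]; apply/existsP; exists u.
by rewrite (subsetP sBB').
Qed.

Lemma iter_propagateS j B B' : B \subset B' ->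
  iter j (@propagate G) B \subset iter j (@propagate G) B'.
Proof. by move=> sBB'; elim: j => //= j; apply: propagateS. Qed.

Lemma arsonist_outcome_sub B R B' :
  B' \in arsonist_outcomes B R -> B \subset B'.
Proof.
rewrite /arsonist_outcomes; case: ifP => _; first by move/set1P->.
by case/imsetP => v _ ->; apply: subsetUr.
Qed.

Lemma arsonist_burn B R v : v \in R -> v \notin B ->
  v |: B \in arsonist_outcomes B R.
Proof.
move=> vR vB; rewrite /arsonist_outcomes; case: ifPn => [/subsetP/(_ v vR)|_].
  by rewrite (negbTE vB).
by apply/imsetP; exists v; rewrite ?inE ?vB.
Qed.

(** If every revealed vertex were burned, [S], which avoids [B], would be empty; with [0 < k] no
    vertex would then be left to reveal, so all would be burned. *)
Lemma exists_burnable B R S : 0 < k -> B != setT -> saboteur_move k B R S ->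
  exists2 v, v \in R :|: S & v \notin B.
Proof.
move=> k0 BT /andP[sS /eqP cS]; apply/subsetPn; apply: contra BT => sRSB.
have/eqP S0: S == set0.
  rewrite -subset0; apply/subsetP => x xS; have := subsetP sS x xS.
  by rewrite !inE (subsetP sRSB) // inE xS orbT.
move: cS; rewrite S0 cards0 => /esym/eqP.
rewrite -leqn0 geq_min leqNgt k0 /= leqn0 card_setC_eq0.
by rewrite (setUidPl (subset_trans (subsetUl _ _) sRSB)).
Qed.

(** Whatever is burned meanwhile, at most one vertex survives the [j]-th propagation, and by
    [exists_burnable] the Arsonist can burn it in that round. *)
Lemma rounds_le_iter_propagate m j B R : 0 < k -> 0 < j ->
  #|~: iter j (@propagate G) B| <= 1 -> rounds k m B R <= j.
Proof.
move=> k0; case: j => // j _; elim: j m B R => [|j IH] [|m] B R H;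
  try exact: leq_trans (rounds_le k 0 B R) _; apply: rounds_leS => S mS.
  have [PT|PT] := eqVneq (propagate B) setT.
    exists setT; last by rewrite rounds_setT.
    by rewrite /arsonist_outcomes PT subsetT set11.
  have [v vRS vP] := exists_burnable k0 PT mS.
  exists (v |: propagate B); first exact: arsonist_burn.
  suff -> : v |: propagate B = setT by rewrite rounds_setT.
  apply/setP => x; rewrite !inE; apply: contraT; rewrite !negb_or.
  case/and3P => xv xP1 xP2; move: H => /=; rewrite leqNgt => /negP[].
  rewrite (cardsD1 x) (cardsD1 v) !inE /= in xP1 xP2 vP *.
  by rewrite (eq_sym v) xv (negbTE xP1) (negbTE xP2) vP.
have /set0Pn[B' oB'] := arsonist_outcomes_neq0 (propagate B) (R :|: S).
exists B' => //; apply: IH; apply: leq_trans H.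
apply: subset_leq_card; rewrite setCS iterSr.
exact/iter_propagateS/(arsonist_outcome_sub oB').
Qed.

End Game.

(** * Hamming distance and the growth of balls under propagation *)

Section Distance.

Variable n : nat.
Implicit Types (u v w c : {set 'I_n}) (B : {set hypercube n}).

Definition dist u v := #|symdiff u v|.

Lemma in_symdiff u v x : (x \in symdiff u v) = (x \in u) (+) (x \in v).
Proof. by rewrite !inE; do 2!case: (x \in _). Qed.

Lemma symdiffC u v : symdiff u v = symdiff v u.
Proof. by apply/setP => x; rewrite !in_symdiff addbC. Qed.

Lemma symdiffA u v w : symdiff u (symdiff v w) = symdiff (symdiff u v) w.
Proof. by apply/setP => x; rewrite !in_symdiff addbA. Qed.

Lemma symdiffK u : involutive (symdiff u).
Proof. by move=> v; apply/setP => x; rewrite !in_symdiff addKb. Qed.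

Lemma symdiffvv u : symdiff u u = set0.
Proof. by rewrite /symdiff setDv setU0. Qed.

Lemma distC u v : dist u v = dist v u.
Proof. by rewrite /dist symdiffC. Qed.

Lemma dist_translate c u v : dist (symdiff c u) (symdiff c v) = dist u v.
Proof.
congr #|pred_of_set _|; apply/setP => x; rewrite !in_symdiff.
by do 3!case: (x \in _).
Qed.

Lemma dist_triangle v u w : dist u w <= dist u v + dist v w.
Proof.
apply: leq_trans (leq_card_setU _ _); apply/subset_leq_card/subsetP => x.
by rewrite in_setU !in_symdiff; do 3!case: (x \in _).
Qed.

Lemma dist_eq0 u v : (dist u v == 0) = (u == v).
Proof.
rewrite cards_eq0; apply/eqP/eqP => [E|->]; last exact: symdiffvv.
by rewrite -[v](symdiffK u) E; apply/setP => x; rewrite in_symdiff inE addbF.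
Qed.

Lemma cards_symdiff u v : dist u v + 2 * #|u :&: v| = #|u| + #|v|.
Proof.
have := cardsUI u v; rewrite /dist => <-.
have -> : u :|: v = symdiff u v :|: (u :&: v).
  by apply/setP => x; rewrite !inE; do 2!case: (x \in _).
rewrite cardsU; have -> : symdiff u v :&: (u :&: v) = set0.
  by apply/setP => x; rewrite !inE; do 2!case: (x \in _).
by rewrite cards0; lia.
Qed.

Lemma mem_propagate B v :
  reflect (exists2 u, u \in B & dist u v <= 1) (v \in propagate B).
Proof.
apply: (iffP idP) => [|[u uB]].
  rewrite !inE => /orP[vB|/existsP[u /andP[uB /eqP duv]]].
    by exists v => //; rewrite /dist symdiffvv cards0.
  by exists u => //; rewrite /dist duv.
rewrite leq_eqVlt ltnS leqn0 dist_eq0 => /orP[/eqP d1|/eqP <-].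
  by rewrite !inE; apply/orP; right; apply/existsP; exists u;
    rewrite uB; apply/eqP.
by rewrite inE uB.
Qed.

Definition ball v r : {set hypercube n} := [set w | dist v w <= r].

Lemma ball_propagate v r B :
  ball v r \subset B -> ball v r.+1 \subset propagate B.
Proof.
move=> /subsetP sB; apply/subsetP => w; rewrite inE => dvw.
have [/eqP d0|] := posnP (dist v w).
  apply/mem_propagate; exists w; last by rewrite /dist symdiffvv cards0.
  by apply: sB; rewrite inE (eqP d0).
rewrite card_gt0 => /set0Pn[x xvw]; apply/mem_propagate.
(* Flipping a coordinate in which [v] and [w] differ gives a neighbor of [w] one step closer to
   [v]. *)
exists (symdiff w [set x]); last first.
  by rewrite distC /dist symdiffK cards1.
apply: sB; rewrite inE -ltnS (leq_trans _ dvw) //.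
have := cards_symdiff (symdiff v w) [set x]; rewrite /dist symdiffA cards1.
have -> : symdiff v w :&: [set x] = [set x] by apply/setIidPr; rewrite sub1set.
by rewrite cards1; lia.
Qed.

Lemma ball_iter_propagate v r j B :
  ball v r \subset B ->
  ball v (r + j) \subset iter j (@propagate (hypercube n)) B.
Proof.
move=> sB; elim: j => [|j IH]; first by rewrite addn0.
by rewrite addnS; apply: ball_propagate.
Qed.

End Distance.

(** * Upper bound: the strategy of the Arsonist *)

Section UpperBound.

Variable n : nat.
Implicit Types (u v w z c : {set 'I_n}) (B R P S : {set hypercube n}).

(** This form suits vertices [v] near the antipode, where [~: v] is small. *)
Lemma dist_setC u v : dist u v + #|u| + #|~: v| = n + 2 * #|u :&: ~: v|.
Proof.
have := cards_symdiff u v; have := cardsC v; have := cardsID v u.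
by rewrite setDE card_ord; lia.
Qed.

Lemma cardsI_set1 u x : #|u :&: [set x]| = (x \in u).
Proof.
have [xu|xu] := boolP (x \in u).
  by rewrite (setIidPr _) ?sub1set // cards1.
by apply/eqP; rewrite cards_eq0 setI_eq0 disjoint_sym disjoints1.
Qed.

(** The fire from [c] reaches radius [n - 2]. A vertex beyond it has a complement of size at most 1
    relative to [c], so by [dist_setC] its distance from [w] is at most [n - (s + 2) + 1], the
    radius reached from [w]. *)
Lemma iter_propagate_far s c w B : 0 < s -> s <= n - 2 -> s + 2 <= dist c w ->
  ball c s.-1 \subset B -> w \in B ->
  iter (n - 1 - s) (@propagate (hypercube n)) B = setT.
Proof.
move=> s0 sn dw cB wB; apply/setP => z; rewrite [RHS]inE.
have /(ball_iter_propagate (n - 1 - s)) /subsetP/(_ z) : ball w 0 \subset B.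
  by apply/subsetP => y; rewrite inE leqn0 dist_eq0 => /eqP <-.
have /subsetP/(_ z) := ball_iter_propagate (n - 1 - s) cB.
rewrite !inE; case: (leqP (dist c z)) => [_ -> //|dz _ -> //].
have := dist_setC (symdiff c w) (symdiff c z); rewrite dist_translate.
have := cardsC (symdiff c z); rewrite card_ord.
have := subset_leq_card (subsetIr (symdiff c w) (~: symdiff c z)).
by rewrite /dist in dw dz *; lia.
Qed.

(** Here [z] survives the propagation of round [n - 1] after [w] is burned in round [n - 2]. The
    fire from [c] leaves [#|Z| <= 1]; if [Z] is a singleton, each of the other three fires would
    reach [z] unless its source contains that element. *)
Lemma unburned_classification c v2 v3 w z : 5 <= n ->
  2 <= dist c v2 -> 3 <= dist c v3 -> n - 3 < dist c w ->
  n - 2 < dist c z -> n - 3 < dist v2 z -> n - 4 < dist v3 z -> 1 < dist w z ->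
  let W := symdiff c w in let V2 := symdiff c v2 in let V3 := symdiff c v3 in
  let Z := ~: symdiff c z in
  [/\ Z = set0, #|V2| = 2, #|V3| = 3 & #|W| + 2 <= n] \/
  (exists x, [/\ Z = [set x], x \in V2 :&: V3, x \in W & #|W| < n]).
Proof.
move=> n5 d2 d3 dw dz d2z d3z dwz W V2 V3 Z.
have := dist_setC V2 (symdiff c z); have := dist_setC V3 (symdiff c z).
have := dist_setC W (symdiff c z); rewrite !dist_translate -/Z.
have := cardsC (symdiff c z); rewrite card_ord -/Z.
have {}d2 : 2 <= #|V2| := d2; have {}d3 : 3 <= #|V3| := d3.
have {}dw : n - 3 < #|W| := dw.
have : dist c z = #|symdiff c z| by [].
case: (posnP #|Z|) => [/eqP|Zgt0].
  rewrite cards_eq0 => /eqP Z0; rewrite Z0 !setI0 !cards0 => H1 H2 H3 H4 H5.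
  by left; split => //; lia.
move=> H1 H2; have /cards1P[x Zx] : #|Z| == 1 by lia.
rewrite Zx !cardsI_set1 cards1 => H3 H4 H5; right; exists x; rewrite inE.
by move: d2 d3 dw H3 H4 H5; do 3!case: (x \in _) => //=; split => //; lia.
Qed.

Section DisjointParts.

Variables (T : finType) (A B C : {set T}).
Hypothesis ABC0 : A :&: B :&: C = set0.

Let setIC_setD : A :&: C = (A :\: B) :&: C.
Proof.
apply/setP => x; move/setP/(_ x): ABC0; rewrite !inE.
by case: (x \in A); case: (x \in B); case: (x \in C).
Qed.

Let setIIC0 : (A :&: C) :&: (B :&: C) = set0.
Proof. by rewrite -setIIl ABC0. Qed.

Lemma leq_cardsI_setD : #|A :&: C| <= #|A :\: B|.
Proof. by rewrite setIC_setD subset_leq_card // subsetIl. Qed.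

Lemma leq_cardsI_disjoint : #|A :&: C| + #|B :&: C| <= #|C|.
Proof.
rewrite -cardsUI setIIC0 cards0 addn0 -setIUl.
by rewrite subset_leq_card // subsetIr.
Qed.

(** Equality in both preceding bounds determines [C] up to its part in [B]. *)
Lemma eq_setU_disjoint : #|A :&: C| = #|A :\: B| ->
  #|A :&: C| + #|B :&: C| = #|C| -> C = (A :\: B) :|: (B :&: C).
Proof.
move=> cA cC; have eA : A :&: C = A :\: B.
  by apply/eqP; rewrite eqEcard -cA leqnn setIC_setD subsetIl.
apply/eqP; rewrite eq_sym eqEcard -eA -setIUl subsetIr -cC setIUl.
by rewrite cardsU setIIC0 cards0 subn0 leqnn.
Qed.

End DisjointParts.

(* Here P is the burned set after the propagation of round n - 2, and burning w
   in that round would leave at least two vertices unburned by the next one. *)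
Lemma undecided_structure c v2 v3 w P : 5 <= n ->
  2 <= dist c v2 <= 3 -> 3 <= dist c v3 <= 4 -> 2 <= dist v2 v3 ->
  ball c (n - 3) \subset P -> ball v2 (n - 4) \subset P ->
  ball v3 (n - 5) \subset P -> w \notin P ->
  1 < #|~: propagate ((w : hypercube n) |: P)| ->
  let V2 := symdiff c v2 in let V3 := symdiff c v3 in
  let C := ~: symdiff c w in
  [/\ #|V3 :\: V2| <= 2, C = (V2 :\: V3) :|: (V3 :&: C), #|V3 :&: C| <= 1
    & V2 :&: V3 :&: C = set0].
Proof.
move=> n5 d2 d3 d23 cP v2P v3P wP /card_gt1P[z1 [z2 [z1P z2P z12]]] V2 V3 C.
set W := symdiff c w in C *.
have unb v r : ball v r \subset P -> r < dist v w.
  move=> /subsetP vP; rewrite ltnNge; apply: contra wP => dvw.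
  by apply: vP; rewrite inE.
have ext v r z : ball v r \subset P ->
    z \in ~: propagate ((w : hypercube n) |: P) -> r.+1 < dist v z.
  move=> vP; rewrite inE => zP; rewrite ltnNge; apply: contra zP => dvz.
  have /ball_propagate/subsetP : ball v r \subset (w : hypercube n) |: P.
    exact: subset_trans vP (subsetUr _ _).
  by apply; rewrite inE.
have extw z : z \in ~: propagate ((w : hypercube n) |: P) -> 1 < dist w z.
  rewrite inE => zP; rewrite ltnNge; apply: contra zP => dwz.
  by apply/mem_propagate; exists w => //; rewrite !inE eqxx.
have cls z : z \in ~: propagate ((w : hypercube n) |: P) ->
    let Z := ~: symdiff c z in
    [/\ Z = set0, #|V2| = 2, #|V3| = 3 & #|W| + 2 <= n] \/
    (exists x, [/\ Z = [set x], x \in V2 :&: V3, x \in W & #|W| < n]).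
  move=> zP; have [d2' _] := andP d2; have [d3' _] := andP d3.
  apply: (unburned_classification n5 d2' d3' (unb _ _ cP) _ _ _ (extw z zP)).
  - by apply: leq_trans (ext _ _ _ cP zP); clear -n5; lia.
  - by apply: leq_trans (ext _ _ _ v2P zP); clear -n5; lia.
  - by apply: leq_trans (ext _ _ _ v3P zP); clear -n5; lia.
have := cards_symdiff V2 V3; rewrite dist_translate => DI.
have inj : ~: symdiff c z1 <> ~: symdiff c z2.
  by move/setC_inj/(can_inj (symdiffK c))/eqP; rewrite (negbTE z12).
(* At most one of the two survivors is the antipode. If neither is, their singletons fill
   [V2 :&: V3], which has at most two elements; if one is, the sizes 2 and 3 and [d23] reduce
   [V2 :&: V3] to the singleton of the other. *)
have [I2W cases] : V2 :&: V3 \subset W /\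
    (#|V2 :&: V3| = 2 /\ #|W| < n \/
     [/\ #|V2 :&: V3| = 1, #|V2| = 2, #|V3| = 3 & #|W| + 2 <= n]).
  have c2 : #|V2| <= 3 by case/andP: d2.
  have c3 : #|V3| <= 4 by case/andP: d3.
  have I2 : #|V2 :&: V3| <= 2 by clear -DI d23 c2 c3; lia.
  have one x : x \in V2 :&: V3 -> x \in W -> #|V2| = 2 -> #|V3| = 3 ->
      V2 :&: V3 \subset W /\ #|V2 :&: V3| = 1.
    move=> xI xW e2 e3; have /cards1P[y Iy] : #|V2 :&: V3| == 1.
      have := cardsD1 x (V2 :&: V3); rewrite xI.
      by clear -e2 e3 DI d23; lia.
    by move: xI; rewrite Iy cards1 inE => /eqP <-; rewrite sub1set.
  case: (cls z1 z1P) => [[e1 a1 b1 w1]|[x [e1 xI xW w1]]];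
  case: (cls z2 z2P) => [[e2 a2 b2 w2]|[y [e2 yI yW w2]]].
  - by rewrite e1 e2 in inj.
  - by have [] := one y yI yW a1 b1; split => //; right.
  - by have [] := one x xI xW a2 b2; split => //; right.
  have xy : x != y by apply: contra_not_neq inj => exy; rewrite e1 e2 exy.
  have sI : [set x; y] \subset V2 :&: V3 by rewrite subUset !sub1set xI.
  have /eqP EI : [set x; y] == V2 :&: V3.
    by rewrite eqEcard sI cards2 xy.
  by rewrite -EI cards2 xy subUset !sub1set xW yW; split => //; left.
have CI : V2 :&: V3 :&: C = set0.
  by apply/eqP; rewrite setI_eq0 disjoints_subset setCK.
have := dist_setC V2 W; have := dist_setC V3 W; rewrite !dist_translate -/C.
have := unb _ _ v2P; have := unb _ _ v3P; have := unb _ _ cP.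
have := cardsC W; rewrite card_ord -/C.
have : dist c w = #|W| by [].
have := leq_cardsI_setD CI; have := leq_cardsI_disjoint CI.
have := cardsID V3 V2; have := cardsID V2 V3; rewrite (setIC V3 V2).
move=> H1 H2 H3 H4 H5 H6 H7 H8 H9 H10 H11.
have c2 : 2 <= #|V2| <= 3 := d2; have c3 : 3 <= #|V3| <= 4 := d3.
(* As the fires from [c], [v2], [v3] have not reached [w], [#|C| <= 2],
   [#|V2| + #|C| <= 3 + 2 * #|V2 :&: C|] and [#|V3| + #|C| <= 4 + 2 * #|V3 :&: C|]. In both cases
   this forces equality in the bounds on disjoint parts. *)
have [p1 [p2 [p3 p4]]] : #|V2 :&: C| = #|V2 :\: V3| /\
    #|V2 :&: C| + #|V3 :&: C| = #|C| /\ #|V3 :&: C| <= 1 /\ #|V3 :\: V2| <= 2.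
  clear -H1 H2 H3 H4 H5 H6 H7 H8 H9 H10 H11 c2 c3 cases DI d23 n5.
  by case: cases => [[? ?]|[? ? ? ?]]; lia.
by split; rewrite // -?eq_setU_disjoint.
Qed.

(** By [undecided_structure], [w] is determined by [V3 :&: C], which is empty or one of at most two
    singletons in [V3 :\: V2]. *)
Lemma undecided_card c v2 v3 P S : 5 <= n ->
  2 <= dist c v2 <= 3 -> 3 <= dist c v3 <= 4 -> 2 <= dist v2 v3 ->
  ball c (n - 3) \subset P -> ball v2 (n - 4) \subset P ->
  ball v3 (n - 5) \subset P -> S \subset ~: P ->
  {in S, forall w : hypercube n, 1 < #|~: propagate (w |: P)|} -> #|S| <= 3.
Proof.
move=> n5 d2 d3 d23 cP v2P v3P /subsetP sSP undec.
have und w (wS : w \in S) : _ := undecided_structure n5 d2 d3 d23 cP v2P v3P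
  (etrans (esym (in_setC _ _)) (sSP _ wS)) (undec w wS).
have [->|[w0 w0S]] := set_0Vmem S; first by rewrite cards0.
have [cE _ _ _] := und w0 w0S; rewrite {w0 w0S}/= in cE und.
set V2 := symdiff c v2 in cE und; set V3 := symdiff c v3 in cE und.
pose f w := V3 :&: ~: symdiff c w.
have injf : {in S &, injective f}.
  move=> w w' /und[_ e _ _] /und[_ e' _ _] ff.
  by move: ff e e'; rewrite /f => -> <- /setC_inj /(can_inj (symdiffK c)) ->.
rewrite -(card_in_imset injf).
apply: (@leq_trans #|set0 |: [set [set x] | x in V3 :\: V2]|); last first.
  rewrite (leq_trans (leq_card_setU _ _)) // cards1.
  by rewrite ltnS (leq_trans (leq_imset_card _ _)).
apply/subset_leq_card/subsetP => _ /imsetP[w /und[_ _ c1 d0] ->].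
rewrite 2!inE -/(f w) in c1 *; case: (posnP #|f w|) => [/eqP|c0].
  by rewrite cards_eq0 => ->.
have /cards1P[x fx] : #|f w| == 1 by rewrite eqn_leq c1.
apply/orP; right; apply/imsetP; exists x => //.
have xf : x \in f w by rewrite fx set11.
move/setP/(_ x): d0; move: xf; rewrite in_set0 !in_setI in_setD.
by case/andP => -> ->; rewrite !andbT => ->.
Qed.

Lemma propagate_dist c B d :
  {in B, forall w, dist c w <= d} ->
  {in propagate B, forall w, dist c w <= d.+1}.
Proof.
move=> Bd w /mem_propagate[u /Bd uB duw].
by rewrite (leq_trans (dist_triangle u _ _)) // -addn1 leq_add.
Qed.

Lemma dist_antipode c : dist c (~: c) = n.
Proof.
rewrite /dist -[RHS](card_ord n) -cardsT; congr #|pred_of_set _|.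
by apply/setP => x; rewrite in_symdiff !inE; case: (x \in c).
Qed.

(** Round [t + 1]: the antipode is still unburned, so some vertex can be burned. If its size exceeds
    [t + 2], then [iter_propagate_far] with [s = t + 1] decides the game; otherwise the last
    hypothesis takes over. *)
Lemma arsonist_step c t m B R : 0 < t -> t + 1 <= n - 2 ->
  ball c t.-1 \subset B -> {in B, forall w, dist c w <= t + 1} ->
  (forall m' (w : hypercube n) R', w \notin propagate B -> dist c w <= t + 2 ->
    rounds 4 m' (w |: propagate B) R' <= n - 2 - t) ->
  rounds 4 m B R <= n - 1 - t.
Proof.
move=> t0 tn cB Bt H; case: m => [|m].
  exact: leq_trans (rounds_le _ _ _ _) _.
have -> : n - 1 - t = (n - 2 - t).+1 by lia.
apply: rounds_leS => S mS; have Pt := propagate_dist Bt.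
have PT : propagate B != setT.
  apply/eqP => PT; have := Pt (~: c); rewrite PT inE dist_antipode => /(_ isT).
  by clear -tn; lia.
have [v vRS vP] := @exists_burnable _ 4 _ _ _ isT PT mS.
exists (v |: propagate B); first exact: arsonist_burn.
have [dv|dv] := leqP (dist c v) (t + 2); first exact: H.
apply: rounds_le_iter_propagate; rewrite ?subn_gt0 //; first by clear -tn; lia.
have -> : n - 2 - t = n - 1 - t.+1 by clear; lia.
rewrite (@iter_propagate_far t.+1 c v) ?setCT ?cards0 //.
- by clear -tn; lia.
- apply: subset_trans (subsetUr _ _); rewrite -[t.+1.-1](prednK t0).
  exact: ball_propagate.
exact: setU11.
Qed.

Lemma arsonist_final_round c v2 v3 m B R : 7 <= n ->
  2 <= dist c v2 <= 3 -> 3 <= dist c v3 <= 4 -> 2 <= dist v2 v3 ->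
  ball c (n - 4) \subset B -> ball v2 (n - 5) \subset B ->
  ball v3 (n - 6) \subset B -> {in B, forall w, dist c w <= n - 2} ->
  rounds 4 m B R <= 2.
Proof.
move=> n7 d2 d3 d23 cB v2B v3B Bt.
case: m => [|m]; first exact: leq_trans (rounds_le _ _ _ _) _.
apply: rounds_leS => S mS; set P := propagate B in mS *.
have cP : ball c (n - 3) \subset P.
  by have -> : n - 3 = (n - 4).+1 by [clear -n7; lia]; apply: ball_propagate.
have v2P : ball v2 (n - 4) \subset P.
  by have -> : n - 4 = (n - 5).+1 by [clear -n7; lia]; apply: ball_propagate.
have v3P : ball v3 (n - 5) \subset P.
  by have -> : n - 5 = (n - 6).+1 by [clear -n7; lia]; apply: ball_propagate.
suff /exists_inP[v vRS /andP[vP win]] :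
    [exists v in R :|: S, (v \notin P) && (#|~: propagate (v |: P)| <= 1)].
  exists (v |: P); first exact: arsonist_burn.
  exact: rounds_le_iter_propagate.
apply: contraT => /exists_inPn undec.
have {}undec (v : hypercube n) : v \in R :|: S -> v \notin P ->
    1 < #|~: propagate (v |: P)|.
  by move=> /undec vRS vP; move: vRS; rewrite vP -ltnNge.
have aP : (~: c : hypercube n) \notin P.
  by apply/negP => /(propagate_dist Bt); rewrite dist_antipode; clear -n7; lia.
have [sS /eqP cS] := andP mS.
have S3 : #|S| <= 3.
  have sSP : S \subset ~: P by rewrite (subset_trans sS) // setCS subsetUl.
  apply: (undecided_card _ d2 d3 d23 cP v2P v3P sSP); first by clear -n7; lia.
  move=> w wS; apply: undec; first by rewrite inE wS orbT.
  by have := subsetP sSP w wS; rewrite inE.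
(* Having revealed fewer than four vertices, the Saboteur has none left, so the antipode is
   revealed. Its size is [s + 2] for [s = n - 2], so burning it is decisive by [iter_propagate_far],
   a contradiction. *)
have ES : S = ~: (P :|: R).
  by apply/eqP; rewrite eqEcard sS; move: cS S3; clear; lia.
have aRS : (~: c : hypercube n) \in R :|: S.
  by rewrite ES in_setU in_setC in_setU (negbTE aP) orbN.
have := undec _ aRS aP.
have := @iter_propagate_far (n - 2) c (~: c) ((~: c : hypercube n) |: P).
have -> : n - 1 - (n - 2) = 1 by clear -n7; lia.
rewrite dist_antipode /= => -> //; first by rewrite setCT cards0.
- by clear -n7; lia.
- by clear -n7; lia.
- have -> : (n - 2).-1 = n - 3 by clear -n7; lia.
  exact: subset_trans cP (subsetUr _ _).
exact: setU11.
Qed.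

(** At the end of round [t] the vertex burned in round [i] has a burned ball of radius [t - i].
    Rounds up to [n - 3] use [arsonist_step], round [n - 2] uses [arsonist_final_round]. *)
Lemma arsonist_wait c v2 v3 t m B R : 7 <= n -> 3 <= t <= n - 3 ->
  2 <= dist c v2 <= 3 -> 3 <= dist c v3 <= 4 -> 2 <= dist v2 v3 ->
  ball c t.-1 \subset B -> ball v2 t.-2 \subset B ->
  ball v3 (t - 3) \subset B -> {in B, forall w, dist c w <= t + 1} ->
  rounds 4 m B R <= n - 1 - t.
Proof.
move=> n7 /andP[t3 tn] d2 d3 d23.
have [r] := ubnP (n - t); elim: r t t3 tn m B R => // r IH t t3 tn m B R tr.
move=> cB v2B v3B Bt; have [et|tlt] := eqVneq t (n - 3).
  have -> : n - 1 - t = 2 by clear -et n7; lia.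
  apply: (arsonist_final_round _ _ n7 d2 d3 d23).
  - by have <- : t.-1 = n - 4 by clear -et; lia.
  - by have <- : t.-2 = n - 5 by clear -et; lia.
  - by have <- : t - 3 = n - 6 by clear -et; lia.
  by have <- : t + 1 = n - 2 by clear -et n7; lia.
have t0 : 0 < t by apply: leq_trans t3.
apply: (arsonist_step (c := c)) => // [|m' w R' wP dw].
  by clear -tlt tn n7; lia.
have -> : n - 2 - t = n - 1 - t.+1 by clear; lia.
have sub v j j' (w' : hypercube n) : ball v j \subset B -> j' = j.+1 ->
    ball v j' \subset w' |: propagate B.
  move=> vB ->; apply: subset_trans (subsetUr _ _); exact: ball_propagate.
apply: IH.
- by clear -t3; lia.
- by clear -tlt tn; lia.
- by clear -tlt tn tr; lia.
- by apply: sub cB _; clear -t3; lia.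
- by apply: sub v2B _; clear -t3; lia.
- by apply: sub v3B _; clear -t3; lia.
move=> u; rewrite 2!inE => /orP[/eqP->|uP]; first by rewrite addSnnS.
by have := propagate_dist Bt uP; rewrite addSn.
Qed.

Lemma liminal_burning_number_le : 7 <= n ->
  liminal_burning_number (hypercube n) 4 <= n - 1.
Proof.
move=> n7; rewrite /liminal_burning_number.
(* The upper bounds hold for every recursion bound, so its value can be forgotten. *)
move: #|hypercube n| => m.
case: m => [|m]; first exact: leq_trans (rounds_le _ _ _ _) _.
have -> : n - 1 = (n - 1 - 1).+1 by clear -n7; lia.
apply: rounds_leS => S; rewrite propagate0 => mS.
have NT : (set0 : {set hypercube n}) != setT.
  by apply/eqP => /setP/(_ (set0 : {set 'I_n})); rewrite !inE.
have [c cS _] := @exists_burnable _ 4 _ _ _ isT NT mS.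
exists (c |: set0); first by apply: arsonist_burn; rewrite // inE.
have cB : ball c 0 \subset c |: set0.
  by apply/subsetP => u; rewrite !inE leqn0 dist_eq0 eq_sym => ->.
apply: (arsonist_step (c := c)) => //; first by clear -n7; lia.
  by move=> w; rewrite !inE orbF => /eqP->; rewrite /dist symdiffvv cards0.
move=> m2 v2 R2; set P1 := propagate _ => v2P d2.
have -> : n - 2 - 1 = n - 1 - 2 by clear; lia.
have cP1 : ball c 1 \subset P1 := ball_propagate cB.
have far v j P : ball v j \subset P ->
    forall w : hypercube n, w \notin P -> j < dist v w.
  move=> /subsetP vP w; rewrite ltnNge; apply: contra => dvw.
  by apply: vP; rewrite inE.
have P1t : {in P1, forall w, dist c w <= 1}.
  move=> w /mem_propagate[u]; rewrite !inE orbF => /eqP-> //.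
have v2B : ball v2 0 \subset v2 |: P1.
  by apply/subsetP => u; rewrite !inE leqn0 dist_eq0 eq_sym => ->.
apply: (arsonist_step (c := c)) => //; first by clear -n7; lia.
- exact: subset_trans cP1 (subsetUr _ _).
- move=> w; rewrite 2!inE => /orP[/eqP->|/P1t] //.
  by move/leq_trans; apply.
move=> m3 v3 R3; set P2 := propagate _ => v3P d3.
have -> : n - 2 - 2 = n - 1 - 3 by clear; lia.
have cP2 : ball c 2 \subset P2.
  by apply: ball_propagate; apply: (subset_trans cP1 (subsetUr _ _)).
have v2P2 : ball v2 1 \subset P2 := ball_propagate v2B.
(* The lower bounds on distances hold because [v2] and [v3] were unburned when chosen; the upper
   bounds are the sizes that [arsonist_step] leaves undecided. *)
apply: (@arsonist_wait c v2 v3) => //.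
- by clear -n7; lia.
- by rewrite d2 andbT; apply: far cP1 _ v2P.
- by rewrite d3 andbT; apply: far cP2 _ v3P.
- exact: far v2P2 _ v3P.
- exact: subset_trans cP2 (subsetUr _ _).
- exact: subset_trans v2P2 (subsetUr _ _).
- by apply/subsetP => u; rewrite inE leqn0 dist_eq0 in_setU1 eq_sym => ->.
move=> w; rewrite 2!inE => /orP[/eqP-> //|].
have P2t : {in v2 |: P1, forall w, dist c w <= 3}.
  move=> u; rewrite 2!inE => /orP[/eqP->|/P1t] //.
  by move/leq_trans; apply.
by move/(propagate_dist P2t).
Qed.

End UpperBound.

(** * Lower bound from a fixed schedule of separated reveals *)

Section Schedule.

Variables (n k N : nat) (T : nat -> {set hypercube n}).
Implicit Types (B R : {set hypercube n}).

Hypothesis cardT : forall s, 1 < s < N -> #|T s| = k.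
Hypothesis cardTN : 1 < #|T N|.
Hypothesis sepT : forall s s' a b, 1 < s < s' -> s' <= N ->
  a \in T s -> b \in T s' -> s' - s < dist a b.

Lemma arsonist_outcomeP B R B' : B' \in arsonist_outcomes B R ->
  B' = B \/ (exists2 v, v \in R & B' = v |: B).
Proof.
rewrite /arsonist_outcomes; case: ifP => _; first by move/set1P; left.
by case/imsetP => v /setDP[vR _] ->; right; exists v.
Qed.

(* (B, R) is a position at the end of round t: the hypothesis on B says that the
   present fire does not reach T s by round s. Revealed vertices can burn only
   from round t + 1 on, hence the weaker hypothesis on R. *)
Lemma rounds_ge_schedule t m B R : 0 < t < N -> N - t < m ->
  {in B, forall w s b, t < s <= N -> b \in T s -> s - t < dist w b} ->
  {in R, forall w s b, t < s <= N -> b \in T s -> s - t <= dist w b} ->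
  N - t < rounds k m B R.
Proof.
have [r] := ubnP (N - t); elim: r t m B R => // r IH t m B R tr.
case: m => // m /andP[t0 tN] tm sepB sepR.
(* Propagation costs one unit of distance, which turns the strict bound into the weak one. *)
have sepP : {in propagate B, forall w s b, t < s <= N -> b \in T s ->
    s - t <= dist w b}.
  move=> w /mem_propagate[u uB duw] s b ts bs.
  have := sepB u uB s b ts bs; have := dist_triangle w u b.
  by clear -duw; lia.
have BT : B != setT.
  apply/eqP => BT; have /card_gt0P[b bN] := ltnW cardTN.
  have := sepB b _ N b _ bN; rewrite BT inE tN leqnn /dist symdiffvv cards0.
  by move=> /(_ isT isT).
have -> : N - t = (N - t.+1).+1 by clear -tN; lia.
(* In round [N] any legal reveal will do: at least two vertices of [T N] survive the propagation and
   the Arsonist burns at most one, so a further round follows. *)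
have [etN|tN1] := eqVneq t.+1 N.
  have [S mS] := saboteur_move_exists k (propagate B) R.
  apply: (@rounds_geS _ k _ _ _ _ S) => // [|B' oB'].
    by clear -tm tN; lia.
  have [b bN bB'] : exists2 b, b \in T N & b \notin B'.
    have TP b : b \in T N -> b \notin propagate B.
      move=> bN; apply/negP => bP; have := sepP b bP N b _ bN.
      by rewrite tN leqnn /dist symdiffvv cards0 => /(_ isT); clear -tN; lia.
    have /card_gt1P[a [b [aN bN ab]]] := cardTN.
    case: (arsonist_outcomeP oB') => [->|[v _ ->]].
      by exists a; rewrite ?TP.
    have [av|av] := eqVneq a v.
      by exists b => //; rewrite in_setU1 negb_or TP // -av eq_sym ab.
    by exists a => //; rewrite in_setU1 negb_or TP // av.
  have -> : N - t.+1 = 0 by rewrite etN subnn.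
  case: m tm => [|m _ /=]; first by clear -tN; lia.
  by case: eqP bB' => [->|//]; rewrite inE.
have {tN1}tN1 : t.+1 < N by rewrite ltn_neqAle tN1.
have disj b : b \in T t.+1 -> (b \notin propagate B) && (b \notin R).
  move=> bT; rewrite -negb_or; apply/negP => bPR.
  suff : t.+1 - t <= dist b b by rewrite /dist symdiffvv cards0; clear; lia.
  by case/orP: bPR => [/sepP|/sepR]; apply => //; rewrite ltnSn ltnW.
have sT : T t.+1 \subset ~: (propagate B :|: R).
  by apply/subsetP => b /disj; rewrite in_setC in_setU negb_or.
have cT : #|T t.+1| = k by apply: cardT; rewrite ltnS t0.
have sepT1 : {in T t.+1, forall w s b, t.+1 < s <= N -> b \in T s ->
    s - t.+1 < dist w b}.
  by move=> w wT s b /andP[ts sN]; apply: sepT => //; rewrite ltnS t0.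
apply: (@rounds_geS _ k _ _ _ _ (T t.+1)) => // [||B' oB'].
- by clear -tm tN; lia.
- rewrite /saboteur_move sT cT; apply/eqP/esym/minn_idPl.
  by rewrite -cT; apply: subset_leq_card.
apply: IH.
- by clear -tr tN1; lia.
- exact: tN1.
- by clear -tm tN1; lia.
(* The required distance drops by one with the new round, so the weak bounds on [propagate B] and
   [R] become strict again; on [T t.+1] strictness is [sepT]. *)
- have sepw w : w \in propagate B \/ w \in R :|: T t.+1 ->
      forall s b, t.+1 < s <= N -> b \in T s -> s - t.+1 < dist w b.
    move=> wP s b /[dup] ts /andP[ts1 sN] bs.
    have wt : s - t <= dist w b -> s - t.+1 < dist w b by clear -ts1; lia.
    have ts' : t < s <= N by rewrite sN ltnW.
    case: wP => [wP|/setUP[wR|wT]]; last exact: sepT1 bs.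
      exact/wt/sepP.
    exact/wt/sepR.
  case: (arsonist_outcomeP oB') => [->|[v vRT ->]] w.
    by move=> wP; apply: sepw; left.
  by case/setU1P => [->|wP]; apply: sepw; [right|left].
move=> w /setUP[wR|wT] s b /[dup] ts /andP[ts1 sN] bs.
  have ts' : t < s <= N by rewrite sN ltnW.
  by have := sepR w wR s b ts' bs; clear -ts1; lia.
exact/ltnW/(sepT1 w wT).
Qed.

End Schedule.

(** * Explicit antichains for the two phases of the schedule *)

Section Separated.

(* All these sets avoid 0, so none contains {0, 1}, whose subsets form the
   initial 4-cycle up to translation. *)
Definition early (s : nat) : seq (seq nat) :=
  nth [::]
    [:: [:: [:: 2; 3]; [:: 2; 4]; [:: 2; 5]; [:: 2; 6]];
        [:: [:: 3; 4; 5]; [:: 3; 4; 6]; [:: 3; 5; 6]; [:: 4; 5; 6]];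
        [:: [:: 3; 4; 7; 8]; [:: 3; 5; 7; 8]; [:: 3; 6; 7; 8]; [:: 4; 5; 7; 8]]]
    (s - 2).

(* An antichain in the subsets of {0, ..., m - 1}, with one set of each size q
   for 1 < q < m: {0, ..., q - 2} and m + 1 - q if 2 q <= m, otherwise
   {0, ..., q} without m - 1 - q. *)
Definition flat (m q : nat) : seq nat :=
  if 2 * q <= m then m + 1 - q :: iota 0 q.-1
  else iota 0 (m - 1 - q) ++ iota (m - q) (q - (m - 1 - q)).

(* The four 3-subsets of {m, ..., m + 3}, which make four copies of flat
   incomparable. *)
Definition tag (m j : nat) : seq nat := [seq m + i | i <- iota 0 4 & i != j].

(** For [s >= 5] the numbers below [n - 5] carry [flat], the next four carry [tag], and [n.-1] is
    the common element. The size is [1 + 3 + (s - 3)], and [s - 3] stays in the range of [flat] for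
    [5 <= s <= n - 3]. *)
Definition sched (n s j : nat) : seq nat :=
  if s < 5 then nth [::] (early s) j
  else n.-1 :: tag (n - 5) j ++ flat (n - 5) (s - 3).

Lemma mem_flat m q x : 1 < q < m -> (x \in flat m q) =
  if 2 * q <= m then (x == m + 1 - q) || (x < q.-1)
  else (x <= q) && (x != m - 1 - q).
Proof.
by rewrite /flat => qm; case: ifP => c; rewrite ?inE ?mem_cat !mem_iota; lia.
Qed.

Lemma flat_uniq m q : 1 < q < m -> uniq (flat m q).
Proof.
rewrite /flat => qm.
case: ifP => c; rewrite /= ?cat_uniq !iota_uniq ?mem_iota ?andbT.
  by lia.
by apply/hasPn => x; rewrite !mem_iota; lia.
Qed.

Lemma size_flat m q : 1 < q < m -> size (flat m q) = q.
Proof.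
by rewrite /flat => qm; case: ifP => c; rewrite /= ?size_cat !size_iota; lia.
Qed.

Lemma flat_lt m q x : 1 < q < m -> x \in flat m q -> x < m.
Proof. by move=> qm; rewrite mem_flat //; case: ifP; lia. Qed.

(** The witness is the isolated element [m + 1 - q] of the smaller set if the larger one does not
    reach it, and otherwise the gap [m - 1 - q'] of the larger set. *)
Lemma flat_notsub m q q' : 1 < q -> q < q' -> q' < m ->
  exists2 x, x \in flat m q & x \notin flat m q'.
Proof.
move=> q1 qq' qm; have qm1 : 1 < q < m by lia.
have qm2 : 1 < q' < m by lia.
have [c|c] := boolP ((2 * q <= m) && ((2 * q' <= m) || (q - 2 < m - 1 - q'))).
  by exists (m + 1 - q); rewrite mem_flat //; case: ifP; lia.
by exists (m - 1 - q'); rewrite mem_flat //; case: ifP; lia.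
Qed.

Lemma mem_tag m j x : (x \in tag m j) = (m <= x < m + 4) && (x != m + j).
Proof.
apply/mapP/idP => [[i]|xm].
  by rewrite mem_filter mem_iota => /andP[ij i4] ->; lia.
by exists (x - m); rewrite ?mem_filter ?mem_iota; lia.
Qed.

Lemma tag_uniq m j : uniq (tag m j).
Proof. by rewrite map_inj_uniq ?filter_uniq ?iota_uniq //; apply: addnI. Qed.

Lemma size_tag m j : j < 4 -> size (tag m j) = 3.
Proof. by rewrite size_map; case: j => [|[|[|[|]]]]. Qed.

Variable n : nat.
Hypothesis n11 : 11 <= n.

(** The first phase does not depend on [n], so its properties are computed for the sizes 2, 3, 4 and
    the four indices. *)
Lemma early_check : all (fun s => all (fun j =>
    let l := nth [::] (early s) j in
    [&& uniq l, all (fun x => x < 9) l, size l == s, 0 \notin l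
      & all (fun s' => all (fun j' => (s <= s') && ((s, j) != (s', j')) ==>
          has [predC nth [::] (early s') j'] l) (iota 0 4)) (iota 2 3)])
  (iota 0 4)) (iota 2 3).
Proof. by vm_compute. Qed.

Lemma sched_spec s j : 1 < s <= n - 3 -> j < 4 ->
  [/\ uniq (sched n s j), {in sched n s j, forall x, x < n}
    & size (sched n s j) = if s < 5 then s else s.+1].
Proof.
move=> sn j4; rewrite /sched; case: ifP => [s5|/negbT s5].
  have s2 : s \in iota 2 3 by rewrite mem_iota; lia.
  have jm : j \in iota 0 4 by rewrite mem_iota.
  have /allP/(_ j jm)/and5P[-> /allP a9 /eqP-> _ _] := allP early_check s s2.
  by split => // x /a9 /= x9; apply: leq_trans n11; lia.
have qm : 1 < s - 3 < n - 5 by lia.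
split.
- rewrite /= mem_cat mem_tag cat_uniq tag_uniq flat_uniq //= andbT.
  rewrite negb_or -andbA; apply/and3P; split; first by lia.
    by apply/negP => /(flat_lt qm); lia.
  by apply/hasPn => x /(flat_lt qm); rewrite mem_tag; lia.
- move=> x; rewrite inE mem_cat mem_tag => /or3P[/eqP->||/(flat_lt qm)]; lia.
by rewrite /= size_cat size_tag // size_flat //; lia.
Qed.

Lemma sched_notsub s s' j j' : 1 < s <= s' -> s' <= n - 3 -> j < 4 -> j' < 4 ->
  (s, j) != (s', j') -> (s < 5) = (s' < 5) ->
  exists2 x, x \in sched n s j & x \notin sched n s' j'.
Proof.
move=> ss' sn j4 j4' neq; rewrite /sched => e5; rewrite -e5.
case: ifP e5 => [s5|/negbT s5] /esym s5'.
  have s2 : s \in iota 2 3 by rewrite mem_iota; lia.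
  have s2' : s' \in iota 2 3 by rewrite mem_iota; lia.
  have jm : j \in iota 0 4 by rewrite mem_iota.
  have jm' : j' \in iota 0 4 by rewrite mem_iota.
  have /allP/(_ j jm)/and5P[_ _ _ _ /allP/(_ s' s2')/allP/(_ j' jm')/implyP] :=
    allP early_check s s2.
  by case/andP: (ss') => _ ->; rewrite neq => /(_ isT)/hasP.
have qm : 1 < s - 3 < n - 5 by lia.
have qm' : 1 < s' - 3 < n - 5 by lia.
have [ej|nj] := eqVneq j j'; last first.
  (* This is the one tag element that index [j'] omits. *)
  exists (n - 5 + j').
    by rewrite inE mem_cat mem_tag; lia.
  rewrite inE mem_cat mem_tag negb_or -andbC; apply/andP; split; last by lia.
  rewrite negb_or; apply/andP; split; first by lia.
  by apply/negP => /(flat_lt qm'); lia.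
have [x xs xs'] : exists2 x,
    x \in flat (n - 5) (s - 3) & x \notin flat (n - 5) (s' - 3).
  apply: flat_notsub; try lia.
  by move: neq; rewrite ej xpair_eqE eqxx andbT; lia.
exists x; first by rewrite inE mem_cat xs !orbT.
have := flat_lt qm xs; rewrite inE mem_cat (negbTE xs') mem_tag; lia.
Qed.

End Separated.

(** * Lower bound: the schedule realized in the cube *)

Section LowerBound.

Variable n : nat.
Hypothesis n11 : 11 <= n.
Implicit Types (c u v : {set 'I_n}).

Definition set_of_nats (l : seq nat) : {set 'I_n} := [set x | val x \in l].

Lemma card_set_of_nats l : uniq l -> {in l, forall x, x < n} ->
  #|set_of_nats l| = size l.
Proof.
move=> ul ln; rewrite cardE -(size_map val).
apply: perm_size; apply: uniq_perm => // [|x].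
  by rewrite map_inj_uniq ?enum_uniq //; apply: val_inj.
apply/mapP/idP => [[y]|xl]; first by rewrite mem_enum inE => yl ->.
by exists (Ordinal (ln x xl)); rewrite ?mem_enum ?inE.
Qed.

Lemma leq_dist_card u v : #|v| <= dist u v + #|u|.
Proof.
have := cards_symdiff u v; have := subset_leq_card (subsetIl u v).
by clear; lia.
Qed.

(** Since [dist u v] is [#|v| - #|u|] plus twice [#|u :\: v|], non-inclusion gains two. *)
Lemma leq_dist_notsub u v : ~~ (u \subset v) -> #|v| + 2 <= dist u v + #|u|.
Proof.
move=> uv; have := cards_symdiff u v; have := cardsID v u.
have : 0 < #|u :\: v| by rewrite card_gt0 setD_eq0.
by clear; lia.
Qed.


Let last_lt : n.-1 < n. Proof. by case: n n11. Qed.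

(** From [s = n - 2] on, all nonzero indices give the same set, so only the two targets remain. *)
Definition stage (s : nat) (j : 'I_4) : {set 'I_n} :=
  if s < n - 2 then set_of_nats (sched n s j)
  else if j == ord0 then setT else ~: [set Ordinal last_lt].

Lemma card_stage s j : 1 < s < n - 2 ->
  #|stage s j| = if s < 5 then s else s.+1.
Proof.
move=> /andP[s1 sn]; rewrite /stage sn.
have [|ul ll <-] := sched_spec n11 _ (ltn_ord j) (s := s); first by lia.
exact: card_set_of_nats.
Qed.

Lemma stage_notsub s s' j j' : 1 < s <= s' -> s' < n - 2 ->
  (s, j) != (s', j') -> (s < 5) = (s' < 5) ->
  ~~ (stage s j \subset stage s' j').
Proof.
move=> ss' sn neq s5; rewrite /stage sn (leq_ltn_trans _ sn); last first.
  by case/andP: ss'.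
have sn' : s' <= n - 3 by lia.
have [x xs xs'] := sched_notsub n11 ss' sn' (ltn_ord j) (ltn_ord j') neq s5.
have [|_ ll _] := sched_spec n11 _ (ltn_ord j) (s := s); first by lia.
by apply/subsetPn; exists (Ordinal (ll x xs)); rewrite inE.
Qed.

Lemma stage_inj s : 1 < s < n - 2 -> injective (stage s).
Proof.
move=> /andP[s1 sn] j j' e; apply/eqP; apply: contraT => jj'.
suff : ~~ (stage s j \subset stage s j') by rewrite e subxx.
by apply: stage_notsub; rewrite ?s1 ?leqnn // xpair_eqE eqxx.
Qed.

(** Within a phase the antichain property gives two units beyond the size difference; across phases
    the sizes [s] and [s' + 1] suffice. Towards the neighbor of the antipode, the common element
    compensates for the larger size [s + 1] of the second phase. *)
Lemma dist_stage s s' j j' : 1 < s < s' -> s' <= n - 2 ->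
  s' - s < dist (stage s j) (stage s' j').
Proof.
move=> ss' sn; have s1n : 1 < s < n - 2 by lia.
have cs := card_stage j s1n.
have [sn'|sn'] := ltnP s' (n - 2).
  have s'1 : 1 < s' < n - 2 by lia.
  have cs' := card_stage j' s'1.
  have [e5|d5] := eqVneq (s < 5) (s' < 5).
    have /leq_dist_notsub : ~~ (stage s j \subset stage s' j').
      by apply: stage_notsub => //; [|rewrite xpair_eqE]; lia.
    by rewrite cs cs' e5; case: ifP; lia.
  have := leq_dist_card (stage s j) (stage s' j'); rewrite cs cs'.
  by move: d5; do 2!case: ifP; lia.
have es' : s' = n - 2 by lia.
have := dist_setC (stage s j) (stage s' j'); rewrite cs.
have -> : stage s' j' = if j' == ord0 then setT else ~: [set Ordinal last_lt].
  by rewrite /stage ltnNge sn'.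
case: ifP => _; first by rewrite setCT setI0 !cards0; case: ifP; lia.
rewrite setCK cards1 cardsI_set1 /stage; have [_ ->] := andP s1n.
rewrite inE /sched; case: ifP => s5; first by lia.
by rewrite inE eqxx /=; lia.
Qed.

Definition square := powerset (set_of_nats [:: 0; 1]).

Lemma leq_card_last_stage s j : n - 2 <= s -> n.-1 <= #|stage s j|.
Proof.
move=> sn; rewrite -[n in n.-1]card_ord -(cardsC1 (Ordinal last_lt)).
rewrite /stage ltnNge sn /=.
by case: ifP => _ //; rewrite subset_leq_card ?subsetT.
Qed.

Lemma leq_card_stage s j : 1 < s <= n - 2 -> s <= #|stage s j|.
Proof.
move=> s1n; have [sn|sn] := ltnP s (n - 2).
  by rewrite card_stage; [case: ifP|]; lia.
by have := leq_card_last_stage j sn; lia.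
Qed.

(** Sizes suffice unless [#|u| = 2] and [s < 5]; then [u] contains 0, which the early sets avoid,
    and [leq_dist_notsub] applies. *)
Lemma dist_square_stage u s j : u \in square -> 1 < s <= n - 2 ->
  s - 1 <= dist u (stage s j).
Proof.
rewrite inE => u01 s1n.
have c01 : #|set_of_nats [:: 0; 1]| = 2.
  by rewrite card_set_of_nats // => x; rewrite !inE; lia.
have cu : #|u| <= 2 by rewrite -c01 subset_leq_card.
have [sn|sn] := ltnP s (n - 2); last first.
  have := leq_dist_card u (stage s j).
  by have := leq_card_last_stage j sn; lia.
have {}s1n : 1 < s < n - 2 by lia.
have cs := card_stage j s1n; have := leq_dist_card u (stage s j).
rewrite cs; case: ifP cs => s5 cs; last by lia.
have [|u2] := leqP #|u| 1; first by lia.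
have u_eq : u = set_of_nats [:: 0; 1] by apply/eqP; rewrite eqEcard u01 c01.
move=> _; have := @leq_dist_notsub u (stage s j); rewrite cs.
have -> : ~~ (u \subset stage s j); last by move=> /(_ isT); lia.
have n0 : 0 < n by lia.
apply/subsetPn; exists (Ordinal n0); first by rewrite u_eq !inE.
have s2 : s \in iota 2 3 by rewrite mem_iota; lia.
have jm : val j \in iota 0 4 by rewrite mem_iota ltn_ord.
have /allP/(_ _ jm)/and5P[_ _ _ z0 _] := allP early_check s s2.
by rewrite /stage; have [_ ->] := andP s1n; rewrite /sched s5 inE.
Qed.

Lemma card_square : #|square| = 4.
Proof.
by rewrite card_powerset card_set_of_nats // => x; rewrite !inE; lia.
Qed.

(** Translation by any vertex of the square preserves it, so all four first choices of the Arsonist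
    are treated alike. *)
Lemma square_symdiff u v :
  u \in square -> v \in square -> symdiff u v \in square.
Proof.
rewrite !inE => us vs; rewrite subUset.
by rewrite !(subset_trans (subsetDl _ _)).
Qed.

Lemma liminal_burning_number_ge :
  n - 1 <= liminal_burning_number (hypercube n) 4.
Proof.
rewrite /liminal_burning_number.
have : n < #|hypercube n|.
  have -> : #|hypercube n| = 2 ^ n.
    by rewrite -cardsT -powersetT card_powerset cardsT card_ord.
  exact: ltn_expl.
case: #|_| => // m nm.
have -> : n - 1 = (n - 2).+1 by lia.
apply: (@rounds_geS _ 4 _ _ _ _ (square : {set hypercube n})) => [|||B'].
- by apply/eqP => /setP/(_ (set0 : {set 'I_n})); rewrite !inE.
- by lia.
- rewrite propagate0 /saboteur_move set0U setC0 subsetT card_square.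
  apply/eqP/esym/minn_idPl; rewrite -card_square.
  exact: subset_leq_card (subsetT _).
have [c0 c0S] : exists c0, c0 \in square by exists set0; rewrite inE sub0set.
rewrite propagate0 set0U /arsonist_outcomes.
case: ifP => [/subsetP/(_ _ c0S)|_].
  by rewrite inE.
case/imsetP => c; rewrite setD0 setU0 => cS -> {B' c0 c0S}.
pose T s : {set hypercube n} := [set symdiff c (stage s j) | j in 'I_4].
(* This prepares the schedule with [N = n - 2] from the end of round [t = 1]: more than [n - 3]
   rounds follow the first. *)
have -> : n - 2 = (n - 2 - 1).+1 by lia.
have inj j j' s : symdiff c (stage s j) = symdiff c (stage s j') ->
    stage s j = stage s j'.
  exact: (can_inj (symdiffK c)).
apply: (@rounds_ge_schedule n 4 (n - 2) T).
- move=> s s1n; rewrite card_imset ?card_ord // => j j' /inj; exact: stage_inj.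
- apply/card_gt1P; exists (symdiff c (stage (n - 2) ord0)).
  exists (symdiff c (stage (n - 2) ord_max)).
  split; try exact: imset_f.
  apply/eqP => /inj; rewrite /stage ltnn /= => /setP/(_ (Ordinal last_lt)).
  by rewrite !inE eqxx.
- move=> s s' _ _ ss' sn /imsetP[j _ ->] /imsetP[j' _ ->].
  by rewrite dist_translate; apply: dist_stage.
- by lia.
- by lia.
- move=> w /set1P-> s _ /andP[s1 sn] /imsetP[j _ ->].
  rewrite /dist symdiffK; apply: leq_trans (leq_card_stage j _); first by lia.
  by rewrite sn andbT; lia.
move=> w wS s _ s1n /imsetP[j _ ->].
rewrite -[w](symdiffK c) dist_translate dist_square_stage //.
exact: square_symdiff.
Qed.

End LowerBound.

Theorem theorem6 (n : nat) (hn : 11 <= n) :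
  liminal_burning_number (hypercube n) 4 = n - 1.
Proof.
apply/eqP; rewrite eqn_leq liminal_burning_number_ge // andbT.
by apply: liminal_burning_number_le; apply: leq_trans hn.
Qed.
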